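(* Consider the complex 3-dimensional Novikov algebras $B_1$, $B_2$, $B_3$, $B_4(\alpha)$ $(\alpha\in\mathbb{C})$, $B_5(\beta)$ $(\beta\in\mathbb{C})$ given by the products listed in the context. For an algebra $A$ and an algebra $B$ from this list, $B$ lies in $\partial O(A)$ if and only if $B$ is isomorphic to one of the algebras given for $A$ below: \begin{itemize} \item $A=B_1$: $B_4(0)$, $B_5(0)$; \item $A=B_2$: $B_1$, $B_3$, $B_4(\alpha)$ for all $\alpha\in\mathbb{C}$, $B_5(\beta)$ for all $\beta\in\mathbb{C}$; \item $A=B_3$: $B_5(\tfrac12)$; \item $A=B_4(\alpha)$ with $\alpha\neq\tfrac12$: $B_5(\alpha)$; \item $A=B_4(\tfrac12)$: $B_3$, $B_5(\tfrac12)$; \item $A=B_5(\beta)$, $\beta\in\mathbb{C}$: none. \end{itemize}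
   Context: A Novikov algebra over $\mathbb{C}$ is a complex vector space with a bilinear product satisfying $(x\cdot y)\cdot z-x\cdot(y\cdot z)=(y\cdot x)\cdot z-y\cdot(x\cdot z)$ and $(x\cdot y)\cdot z=(x\cdot z)\cdot y$ for all $x,y,z$. Fix a 3-dimensional complex vector space $V$ with basis $(e_1,e_2,e_3)$. The set of Novikov products on $V$, identified with their structure constants in $\mathbb{C}^{27}$, is an affine algebraic set, on which $GL_3(\mathbb{C})$ acts by $(g\circ\mu)(x,y)=g(\mu(g^{-1}x,g^{-1}y))$. For a 3-dimensional Novikov algebra $A$, $O(A)$ is the orbit of a structure representing $A$, $\overline{O(A)}$ its Zariski closure, and $\partial O(A)=\overline{O(A)}\setminus O(A)$; ''$B$ lies in $\partial O(A)$'' means that a structure representing $B$ lies in $\partial O(A)$. The algebras (basis $e_1,e_2,e_3$; products of basis vectors not listed are zero): $B_1$: $e_1e_1=e_1$, $e_1e_2=e_2+e_3$, $e_1e_3=e_3$, $e_2e_1=e_2$, $e_3e_1=e_3$. $B_2$: $e_1e_1=e_1$, $e_1e_2=e_2+e_3$, $e_1e_3=e_3$, $e_2e_1=e_2$, $e_2e_2=e_3$, $e_3e_1=e_3$. $B_3$: $e_1e_2=\frac12e_3$, $e_2e_1=-\frac12e_3$, $e_2e_2=e_3$. $B_4(\alpha)$: $e_1e_2=\alpha e_3$, $e_2e_1=(\alpha-1)e_3$, $e_2e_2=e_1$. $B_5(\beta)$: $e_1e_2=\beta e_3$, $e_2e_1=(\beta-1)e_3$. The only isomorphisms among these algebras are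 $B_5(\beta)\cong B_5(1-\beta)$. *)

(* Defs.v *)
From mathcomp Require Import all_boot all_order all_algebra.
From mathcomp Require Import ring.
From mathcomp Require Export reals complex mpoly.

Set Implicit Arguments.
Unset Strict Implicit.
Unset Printing Implicit Defensive.

Import GRing.Theory.
Local Open Scope ring_scope.

(* An algebra structure on V = F^3 (column vectors), given by its 27 structure
   constants: c (i, j, k) is the coefficient of e_k in the product e_i e_j. *)
Definition coord : finType := ('I_3 * 'I_3 * 'I_3)%type.
Definition structure (F : fieldType) : Type := {ffun coord -> F}.

Definition mul (F : fieldType) (c : structure F) (x y : 'cV[F]_3) : 'cV[F]_3 :=
  \col_k \sum_i \sum_j c (i, j, k) * x i 0 * y j 0.

Definition novikov (F : fieldType) (c : structure F) : Prop :=
  forall x y z : 'cV[F]_3,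
    mul c (mul c x y) z - mul c x (mul c y z) =
      mul c (mul c y x) z - mul c y (mul c x z) /\
    mul c (mul c x y) z = mul c (mul c x z) y.

(* The k-th basis vector for 1 <= k <= 3 (numbering from 1). *)
Definition e (F : fieldType) (k : nat) : 'cV[F]_3 :=
  \col_i (i.+1 == k)%:R.
Arguments e {F} k.

Definition structure_of_basis_products (F : fieldType)
    (m : 'I_3 -> 'I_3 -> 'cV[F]_3) : structure F :=
  [ffun t => m t.1.1 t.1.2 t.2 0].

Definition act (F : fieldType) (g : 'M[F]_3) (c : structure F) : structure F :=
  structure_of_basis_products (fun i j : 'I_3 =>
    g *m mul c (invmx g *m e i.+1) (invmx g *m e j.+1)).

Definition orbit (F : fieldType) (c d : structure F) : Prop :=
  exists2 g : 'M[F]_3, g \in unitmx & d = act g c.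

(* Evaluation of a polynomial in 27 variables at a point of F^27, the variables
   being indexed by the triples (i, j, k) through their enumeration. *)
Definition eval_at (F : fieldType) (c : structure F)
    (p : {mpoly F[#|{: coord}|]}) : F :=
  p.@[fun t => c (enum_val t)].

(* Closure for the Zariski topology on the set of Novikov structures, i.e. the
   topology induced from the affine space F^27. *)
Definition zariski_closure (F : fieldType) (S : structure F -> Prop)
    (d : structure F) : Prop :=
  novikov d /\
  forall p : {mpoly F[#|{: coord}|]},
    (forall c, S c -> eval_at c p = 0) -> eval_at d p = 0.

Definition boundary (F : fieldType) (c d : structure F) : Prop :=
  zariski_closure (orbit c) d /\ ~ orbit c d.

Definition isomorphic (F : fieldType) (c d : structure F) : Prop :=
  exists2 f : 'M[F]_3, f \in unitmx &
    forall x y : 'cV[F]_3, f *m mul c x y = mul d (f *m x) (f *m y).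

Definition in_boundary (F : fieldType) (b a : structure F) : Prop :=
  exists2 d : structure F, isomorphic d b & boundary a d.

Inductive algebra (F : fieldType) : Type :=
  B1 | B2 | B3 | B4 of F | B5 of F.
Arguments B1 {F}.
Arguments B2 {F}.
Arguments B3 {F}.

Definition basis_product (F : fieldType) (A : algebra F) (i j : nat) :
    'cV[F]_3 :=
  match A, i, j with
  | B1, 1%N, 1%N => e 1
  | B1, 1%N, 2%N => e 2 + e 3
  | B1, 1%N, 3%N => e 3
  | B1, 2%N, 1%N => e 2
  | B1, 3%N, 1%N => e 3
  | B2, 1%N, 1%N => e 1
  | B2, 1%N, 2%N => e 2 + e 3
  | B2, 1%N, 3%N => e 3
  | B2, 2%N, 1%N => e 2
  | B2, 2%N, 2%N => e 3
  | B2, 3%N, 1%N => e 3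
  | B3, 1%N, 2%N => 2^-1 *: e 3
  | B3, 2%N, 1%N => - 2^-1 *: e 3
  | B3, 2%N, 2%N => e 3
  | B4 a, 1%N, 2%N => a *: e 3
  | B4 a, 2%N, 1%N => (a - 1) *: e 3
  | B4 a, 2%N, 2%N => e 1
  | B5 b, 1%N, 2%N => b *: e 3
  | B5 b, 2%N, 1%N => (b - 1) *: e 3
  | _, _, _ => 0
  end.

Definition structure_of (F : fieldType) (A : algebra F) : structure F :=
  structure_of_basis_products (fun i j : 'I_3 => basis_product A i.+1 j.+1).

Coercion structure_of : algebra >-> structure.

Lemma structure_of_novikov (F : fieldType) (A : algebra F) : novikov A.
Proof.
pose i1 : 'I_3 := lift ord0 ord0; pose i2 : 'I_3 := lift ord0 (lift ord0 ord0).
have mulE (x y : 'cV[F]_3) k : mul A x y k 0 =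
    \sum_(t <- [:: (ord0, ord0); (ord0, i1); (ord0, i2); (i1, ord0); (i1, i1);
                   (i1, i2); (i2, ord0); (i2, i1); (i2, i2)])
      basis_product A t.1.+1 t.2.+1 k 0 * x t.1 0 * y t.2 0.
  rewrite mxE !big_ord_recl !big_ord0 !big_cons big_nil /=.
  by rewrite /structure_of /structure_of_basis_products !ffunE /= ?big_ord0 !addr0 !addrA.
have subE (u v : 'cV[F]_3) k : (u - v) k 0 = u k 0 - v k 0 by rewrite !mxE.
have k3 (P : 'I_3 -> Prop) : P ord0 -> P i1 -> P i2 -> forall k, P k.
  move=> P0 P1 P2 [[|[|[|//]]] lt_k3].
  - by rewrite (_ : Ordinal _ = ord0) //; apply: val_inj.
  - by rewrite (_ : Ordinal _ = i1) //; apply: val_inj.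
  - by rewrite (_ : Ordinal _ = i2) //; apply: val_inj.
have eE k (i : 'I_3) : e k i 0 = (i.+1 == k)%:R :> F by rewrite mxE.
have ZE a k (i : 'I_3) : (a *: e k) i 0 = a * (i.+1 == k)%:R :> F.
  by rewrite !mxE.
have DE (i : 'I_3) : (e 2 + e 3) i 0 = (i.+1 == 2)%:R + (i.+1 == 3)%:R :> F.
  by rewrite !mxE.
have oE (i : 'I_3) : (0 : 'cV[F]_3) i 0 = 0 by rewrite mxE.
pose simp := (oE, eE, ZE, DE, mul0r, mulr0, mulr1, mul1r, addr0, add0r).
case: A mulE => [||| a | b] mulE x y z.
- have M0 (u v : 'cV[F]_3) : mul B1 u v ord0 0 = u ord0 0 * v ord0 0.
    by rewrite mulE !big_cons big_nil /= !simp.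
  have M1 (u v : 'cV[F]_3) : mul B1 u v i1 0 = u ord0 0 * v i1 0 + u i1 0 * v ord0 0.
    by rewrite mulE !big_cons big_nil /= !simp.
  have M2 (u v : 'cV[F]_3) : mul B1 u v i2 0 =
      u ord0 0 * v i1 0 + (u ord0 0 * v i2 0 + u i2 0 * v ord0 0).
    by rewrite mulE !big_cons big_nil /= !simp.
  by split; apply/colP; apply: k3; rewrite ?subE !(M0, M1, M2); ring.
- have M0 (u v : 'cV[F]_3) : mul B2 u v ord0 0 = u ord0 0 * v ord0 0.
    by rewrite mulE !big_cons big_nil /= !simp.
  have M1 (u v : 'cV[F]_3) : mul B2 u v i1 0 = u ord0 0 * v i1 0 + u i1 0 * v ord0 0.
    by rewrite mulE !big_cons big_nil /= !simp.
  have M2 (u v : 'cV[F]_3) : mul B2 u v i2 0 = u ord0 0 * v i1 0 +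
      (u ord0 0 * v i2 0 + (u i1 0 * v i1 0 + u i2 0 * v ord0 0)).
    by rewrite mulE !big_cons big_nil /= !simp.
  by split; apply/colP; apply: k3; rewrite ?subE !(M0, M1, M2); ring.
- have M0 (u v : 'cV[F]_3) : mul B3 u v ord0 0 = 0.
    by rewrite mulE !big_cons big_nil /= !simp.
  have M1 (u v : 'cV[F]_3) : mul B3 u v i1 0 = 0.
    by rewrite mulE !big_cons big_nil /= !simp.
  have M2 (u v : 'cV[F]_3) : mul B3 u v i2 0 = 2^-1 * u ord0 0 * v i1 0 +
      (- 2^-1 * u i1 0 * v ord0 0 + u i1 0 * v i1 0).
    by rewrite mulE !big_cons big_nil /= !simp.
  by split; apply/colP; apply: k3;
    rewrite ?subE !(M0, M1, M2) ?(mulr0, mul0r, addr0, subr0).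
- have M0 (u v : 'cV[F]_3) : mul (B4 a) u v ord0 0 = u i1 0 * v i1 0.
    by rewrite mulE !big_cons big_nil /= !simp.
  have M1 (u v : 'cV[F]_3) : mul (B4 a) u v i1 0 = 0.
    by rewrite mulE !big_cons big_nil /= !simp.
  have M2 (u v : 'cV[F]_3) : mul (B4 a) u v i2 0 =
      a * u ord0 0 * v i1 0 + (a - 1) * u i1 0 * v ord0 0.
    by rewrite mulE !big_cons big_nil /= !simp.
  by split; apply/colP; apply: k3; rewrite ?subE !(M0, M1, M2); ring.
- have M0 (u v : 'cV[F]_3) : mul (B5 b) u v ord0 0 = 0.
    by rewrite mulE !big_cons big_nil /= !simp.
  have M1 (u v : 'cV[F]_3) : mul (B5 b) u v i1 0 = 0.
    by rewrite mulE !big_cons big_nil /= !simp.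
  have M2 (u v : 'cV[F]_3) : mul (B5 b) u v i2 0 =
      b * u ord0 0 * v i1 0 + (b - 1) * u i1 0 * v ord0 0.
    by rewrite mulE !big_cons big_nil /= !simp.
  by split; apply/colP; apply: k3;
    rewrite ?subE !(M0, M1, M2) ?(mulr0, mul0r, addr0, subr0).
Qed.

(* Main.v *)
From Pilot Require Import Defs.
From mathcomp Require Import all_boot all_order all_algebra ring.
From mathcomp Require Import reals complex.

Set Implicit Arguments.
Unset Strict Implicit.
Unset Printing Implicit Defensive.

(* The last module gives back to mul and orbit their meaning for structures. *)
Import GRing.Theory Num.Theory Pilot.Defs.
Local Open Scope ring_scope.
Local Open Scope complex_scope.

(** Orbits are isomorphism classes, so B lies in the boundary of O(A) exactly
when A and B are not isomorphic and A degenerates to B, in the sense that every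
polynomial in the structure constants vanishing on the orbit of A vanishes at B.

The five algebras sit in two families: B1 and B2 are [unital 0] and [unital 1],
while B4(a), B3 and B5(b) are [nil_alg a 1 0], [nil_alg (1/2) 0 1] and
[nil_alg b 0 0].

Existence.  If a curve of structures, polynomial in t, stays in one orbit for
t != 0, then this orbit degenerates to the value of the curve at t = 0
([degenerates_curve]), and degenerations compose ([degenerates_trans]).  Most
of the curves needed come from rescaling or shearing a basis; the ones from a
unital algebra to B4(a) are given by [collapsing].

Obstructions.  For scalars p, q, r, let
N(x, y) = p xy + q yx + r (tr(L_x) y + tr(L_y) x), where L_x is left
multiplication by x.  That the linear map x |-> N(x, .) has rank at most one
is expressed by the vanishing of 2 x 2 minors, so it is invariant under
isomorphism and passes to degenerations ([left_rank_le1_invariant]).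
- For p = a - 1, q = -a, r = 0 it holds on [nil_alg a u v], because N(x, y)
  there depends on x only through x_2; it fails on unital algebras, forces b = a
  on B4(b), b = a or b = 1 - a on B5(b), and a = 1/2 on B3.
- For p = 1, q = 0, r = -1/3 it holds on B1, where xy is
  x_1 y + y_1 x + x_1 (y_2 e_3 - y_1 e_1); it fails on B2 and B3, forces b = 0
  on B4(b), and b = 0 or b = 1 on B5(b).
Two further closed conditions do the rest: the vanishing of all triple products
fails on B4, and the vanishing of all squares tells B3 from B5(1/2). *)

(** * Coordinates *)

Definition i0 : 'I_3 := ord0.
Definition i1 : 'I_3 := lift ord0 ord0.
Definition i2 : 'I_3 := lift ord0 (lift ord0 ord0).

Lemma ord3_ind (P : 'I_3 -> Prop) : P i0 -> P i1 -> P i2 -> forall k, P k.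
Proof.
move=> P0 P1 P2 [[|[|[|//]]] lt_k3].
- by rewrite (_ : Ordinal _ = i0) //; apply: val_inj.
- by rewrite (_ : Ordinal _ = i1) //; apply: val_inj.
- by rewrite (_ : Ordinal _ = i2) //; apply: val_inj.
Qed.

Lemma sum_ord3 (V : nmodType) (h : 'I_3 -> V) :
  \sum_i h i = h i0 + h i1 + h i2.
Proof. by rewrite !big_ord_recl big_ord0 addr0 addrA. Qed.

Definition vec (F : fieldType) (a b c : F) : 'cV[F]_3 :=
  \col_k nth 0 [:: a; b; c] k.

Lemma vecE (F : fieldType) (x : 'cV[F]_3) : x = vec (x i0 0) (x i1 0) (x i2 0).
Proof. by apply/colP; apply: ord3_ind; rewrite mxE. Qed.

Lemma vec_ind (F : fieldType) (P : 'cV[F]_3 -> Prop) :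
  (forall a b c, P (vec a b c)) -> forall x, P x.
Proof. by move=> Pvec x; rewrite [x]vecE. Qed.

Lemma vec0 (F : fieldType) : 0 = vec 0 0 0 :> 'cV[F]_3.
Proof. by apply/colP; apply: ord3_ind; rewrite !mxE. Qed.

Lemma vecD (F : fieldType) (a b c a' b' c' : F) :
  vec a b c + vec a' b' c' = vec (a + a') (b + b') (c + c').
Proof. by apply/colP; apply: ord3_ind; rewrite !mxE. Qed.

Lemma vecZ (F : fieldType) (t a b c : F) :
  t *: vec a b c = vec (t * a) (t * b) (t * c).
Proof. by apply/colP; apply: ord3_ind; rewrite !mxE. Qed.

Lemma e_vec (F : fieldType) :
  (e 1 = vec 1 0 0 :> 'cV[F]_3) * (e 2 = vec 0 1 0 :> 'cV[F]_3) *
  (e 3 = vec 0 0 1 :> 'cV[F]_3).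
Proof. by do !split; apply/colP; apply: ord3_ind; rewrite !mxE. Qed.

Lemma vec_inj (F : fieldType) (a b c a' b' c' : F) :
  vec a b c = vec a' b' c' -> [/\ a = a', b = b' & c = c'].
Proof.
move=> eq_v; split; [move/colP/(_ i0): eq_v | move/colP/(_ i1): eq_v
  | move/colP/(_ i2): eq_v]; by rewrite !mxE.
Qed.

(** The matrix sending the standard basis to u, v, w: isomorphisms below are
given by naming, in the target, the image of the basis of the source. *)
Definition from_columns (F : fieldType) (u v w : 'cV[F]_3) : 'M[F]_3 :=
  \matrix_(k, j) nth 0 [:: u; v; w] j k 0.

Lemma from_columns_mul (F : fieldType) (u v w : 'cV[F]_3) (a b c : F) :
  from_columns u v w *m vec a b c = a *: u + b *: v + c *: w.
Proof. by apply/colP=> k; rewrite !mxE sum_ord3 !mxE /=; ring. Qed.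

Lemma det_from_columns (F : fieldType) (a b c a' b' c' a'' b'' c'' : F) :
  \det (from_columns (vec a b c) (vec a' b' c') (vec a'' b'' c'')) =
    a * (b' * c'' - b'' * c') - a' * (b * c'' - b'' * c)
    + a'' * (b * c' - b' * c).
Proof.
rewrite (expand_det_row _ i0) sum_ord3 /cofactor.
do ![rewrite (expand_det_row _ ord0) !big_ord_recl !big_ord0 /cofactor].
rewrite !det_mx00 !mxE /= /bump /=; ring.
Qed.

Lemma outer_prodE (F : fieldType) (u v : 'cV[F]_3) (k l : 'I_3) :
  (u *m v^T) k l = u k 0 * v l 0.
Proof. by rewrite mxE big_ord1 mxE. Qed.

(** * Structures and their isomorphisms *)

Lemma col_sum_e (F : fieldType) (x : 'cV[F]_3) : x = \sum_i x i 0 *: e i.+1.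
Proof.
rewrite sum_ord3 /= !e_vec !vecZ !vecD [LHS]vecE; congr vec; ring.
Qed.

Definition left_mul (F : fieldType) (c : structure F) (x : 'cV[F]_3) :
    'M[F]_3 :=
  \matrix_(k, j) \sum_i c (i, j, k) * x i 0.

Lemma left_mulE (F : fieldType) (c : structure F) (x y : 'cV[F]_3) :
  left_mul c x *m y = mul c x y.
Proof.
apply/colP=> k; rewrite !mxE exchange_big; apply: eq_bigr => j _ /=.
by rewrite mxE mulr_suml.
Qed.

Lemma mulr_sum_scaled (F : fieldType) (c : structure F) (x : 'cV[F]_3)
    (a : 'I_3 -> F) (v : 'I_3 -> 'cV[F]_3) :
  mul c x (\sum_j a j *: v j) = \sum_j a j *: mul c x (v j).
Proof.
rewrite -left_mulE mulmx_sumr; apply: eq_bigr => j _.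
by rewrite -scalemxAr left_mulE.
Qed.

Lemma mull_sum_scaled (F : fieldType) (c : structure F) (y : 'cV[F]_3)
    (a : 'I_3 -> F) (v : 'I_3 -> 'cV[F]_3) :
  mul c (\sum_i a i *: v i) y = \sum_i a i *: mul c (v i) y.
Proof.
apply/colP=> k; rewrite !sum_ord3 !mxE !sum_ord3 !mxE; ring.
Qed.

Lemma mul_structure_of_basis_products (F : fieldType)
    (m : 'I_3 -> 'I_3 -> 'cV[F]_3) (x y : 'cV[F]_3) :
  mul (structure_of_basis_products m) x y =
    \sum_i \sum_j (x i 0 * y j 0) *: m i j.
Proof.
apply/colP=> k; rewrite mxE summxE; apply: eq_bigr => i _.
rewrite summxE; apply: eq_bigr => j _; rewrite !mxE !ffunE /=; ring.
Qed.

Lemma mul_e (F : fieldType) (c : structure F) (i j k : 'I_3) :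
  mul c (e i.+1) (e j.+1) k 0 = c (i, j, k).
Proof.
by rewrite mxE !sum_ord3; elim/ord3_ind: i; elim/ord3_ind: j;
   rewrite !mxE /=; ring.
Qed.

Lemma mul_inj (F : fieldType) (c d : structure F) :
  (forall x y, mul c x y = mul d x y) -> c = d.
Proof.
move=> eq_mul; apply/ffunP=> -[[i j] k]; by rewrite -!mul_e eq_mul.
Qed.

(** Being given on the basis, the structure [act g c] is compared with the
transported product by bilinearity. *)
Lemma mul_act (F : fieldType) (g : 'M[F]_3) (c : structure F) (x y : 'cV[F]_3) :
  mul (act g c) x y = g *m mul c (invmx g *m x) (invmx g *m y).
Proof.
rewrite mul_structure_of_basis_products {2}[x]col_sum_e mulmx_sumr.
under [in RHS]eq_bigr do rewrite -scalemxAr.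
rewrite mull_sum_scaled mulmx_sumr; apply: eq_bigr => i _.
rewrite -scalemxAr {2}[y]col_sum_e mulmx_sumr.
under [in RHS]eq_bigr do rewrite -scalemxAr.
rewrite mulr_sum_scaled mulmx_sumr scaler_sumr; apply: eq_bigr => j _.
by rewrite -scalemxAr scalerA.
Qed.

Lemma orbitP (F : fieldType) (c d : structure F) :
  orbit c d <-> isomorphic c d.
Proof.
split=> -[g g_unit gP]; exists g => //.
  by move=> x y; rewrite gP mul_act !mulKmx.
by apply: mul_inj => x y; rewrite mul_act gP !mulKVmx.
Qed.

Lemma isomorphic_refl (F : fieldType) (c : structure F) : isomorphic c c.
Proof. by exists 1%:M; rewrite ?unitmx1 // => x y; rewrite !mul1mx. Qed.

Lemma isomorphic_sym (F : fieldType) (c d : structure F) :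
  isomorphic c d -> isomorphic d c.
Proof.
move=> [f f_unit fP]; exists (invmx f); rewrite ?unitmx_inv // => x y.
by rewrite -{1}[x](mulKVmx f_unit) -{1}[y](mulKVmx f_unit) -fP mulKmx.
Qed.

Lemma isomorphic_trans (F : fieldType) (b c d : structure F) :
  isomorphic b c -> isomorphic c d -> isomorphic b d.
Proof.
move=> [f f_unit fP] [g g_unit gP]; exists (g *m f).
  by rewrite unitmx_mul g_unit.
by move=> x y; rewrite -!mulmxA fP gP.
Qed.

Lemma isomorphic_from_columns (F : fieldType) (c d : structure F)
    (u v w : 'cV[F]_3) :
  \det (from_columns u v w) != 0 ->
  (forall x y, from_columns u v w *m mul c x y =
    mul d (from_columns u v w *m x) (from_columns u v w *m y)) ->
  isomorphic c d.
Proof.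
by move=> det0 fP; exists (from_columns u v w); rewrite // unitmxE unitfE.
Qed.

(** * Polynomial functions and degenerations *)

(** Polynomial functions of a point s of a parameter set X whose coordinates are
x i s.  The same notion serves on the space of structures, where it yields
multivariate polynomials, and on the line of a curve parameter, where it yields
univariate ones.  The last constructor avoids any appeal to function
extensionality. *)
Inductive polynomial_in (F : fieldType) (I X : Type) (x : I -> X -> F) :
    (X -> F) -> Prop :=
| poly_const a : polynomial_in x (fun _ => a)
| poly_var i : polynomial_in x (x i)
| poly_add h1 h2 : polynomial_in x h1 -> polynomial_in x h2 ->
    polynomial_in x (fun s => h1 s + h2 s)
| poly_mul h1 h2 : polynomial_in x h1 -> polynomial_in x h2 ->
    polynomial_in x (fun s => h1 s * h2 s)
| poly_ext h1 h2 : h1 =1 h2 -> polynomial_in x h1 -> polynomial_in x h2.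

Lemma poly_opp (F : fieldType) (I X : Type) (x : I -> X -> F) h :
  polynomial_in x h -> polynomial_in x (fun s => - h s).
Proof.
move=> hP; apply: poly_ext (poly_mul (poly_const x (-1)) hP).
by move=> s; rewrite mulN1r.
Qed.

Lemma poly_sum (F : fieldType) (I X : Type) (x : I -> X -> F)
    (J : Type) (r : seq J) (h : J -> X -> F) :
  (forall j, polynomial_in x (h j)) ->
  polynomial_in x (fun s => \sum_(j <- r) h j s).
Proof.
move=> hP; elim: r => [|j r IHr].
  by apply: poly_ext (poly_const x 0) => s; rewrite big_nil.
by apply: poly_ext (poly_add (hP j) IHr) => s; rewrite big_cons.
Qed.

Lemma poly_prod (F : fieldType) (I X : Type) (x : I -> X -> F)
    (J : Type) (r : seq J) (h : J -> X -> F) :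
  (forall j, polynomial_in x (h j)) ->
  polynomial_in x (fun s => \prod_(j <- r) h j s).
Proof.
move=> hP; elim: r => [|j r IHr].
  by apply: poly_ext (poly_const x 1) => s; rewrite big_nil.
by apply: poly_ext (poly_mul (hP j) IHr) => s; rewrite big_cons.
Qed.

Lemma poly_exp (F : fieldType) (I X : Type) (x : I -> X -> F) h n :
  polynomial_in x h -> polynomial_in x (fun s => h s ^+ n).
Proof.
move=> hP; elim: n => [|n IHn]; first exact: poly_const.
by apply: poly_ext (poly_mul hP IHn) => s; rewrite exprS.
Qed.

(** A polynomial in the structure constants stays polynomial when these constants
vary polynomially: this serves both for restricting to a curve and for
translating a polynomial by an element of the group. *)
Lemma poly_eval_at (F : fieldType) (I X : Type) (x : I -> X -> F)
    (u : X -> structure F) (p : {mpoly F[#|{: coord}|]}) :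
  (forall t, polynomial_in x (fun s => u s t)) ->
  polynomial_in x (fun s => eval_at (u s) p).
Proof.
move=> uP; pose term m s := p@_m * \prod_i u s (enum_val i) ^+ m i.
apply: (@poly_ext _ _ _ _ (fun s => \sum_(m <- msupp p) term m s)).
  by move=> s; rewrite /eval_at mevalE.
apply: poly_sum => m; apply: poly_mul; first exact: poly_const.
by apply: poly_prod => i; apply: poly_exp.
Qed.

Lemma poly_structure (F : fieldType) (I X : Type) (x : I -> X -> F)
    (m : X -> 'I_3 -> 'I_3 -> 'cV[F]_3) :
  (forall i j k, polynomial_in x (fun s => m s i j k 0)) ->
  forall t, polynomial_in x (fun s => structure_of_basis_products (m s) t).
Proof.
by move=> mP [[i j] k]; apply: poly_ext (mP i j k) => s; rewrite ffunE.
Qed.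

Lemma poly_col_add (F : fieldType) (I X : Type) (x : I -> X -> F)
    (u v : X -> 'cV[F]_3) k :
  polynomial_in x (fun s => u s k 0) -> polynomial_in x (fun s => v s k 0) ->
  polynomial_in x (fun s => (u s + v s) k 0).
Proof.
by move=> uP vP; apply: poly_ext (poly_add uP vP) => s; rewrite [RHS]mxE.
Qed.

Lemma poly_col_scale (F : fieldType) (I X : Type) (x : I -> X -> F)
    (h : X -> F) (v : 'cV[F]_3) k :
  polynomial_in x h -> polynomial_in x (fun s => (h s *: v) k 0).
Proof.
move=> hP; apply: poly_ext (poly_mul hP (poly_const x (v k 0))) => s.
by rewrite [RHS]mxE.
Qed.

Definition coordinate (F : fieldType) (t : coord) (c : structure F) : F := c t.

Lemma polynomial_in_coordinates (F : fieldType) (h : structure F -> F) :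
  polynomial_in (@coordinate F) h ->
  exists p : {mpoly F[#|{: coord}|]}, forall c, eval_at c p = h c.
Proof.
elim=> [a | t | h1 h2 _ [p1 p1P] _ [p2 p2P] | h1 h2 _ [p1 p1P] _ [p2 p2P]
       | h1 h2 eq_h _ [p pP]].
- by exists a%:MP => c; rewrite /eval_at mevalC.
- by exists 'X_(enum_rank t) => c; rewrite /eval_at mevalXU enum_rankK.
- by exists (p1 + p2) => c; rewrite -p1P -p2P /eval_at mevalD.
- by exists (p1 * p2) => c; rewrite -p1P -p2P /eval_at mevalM.
- by exists p => c; rewrite pP eq_h.
Qed.

Definition line (F : fieldType) (_ : unit) (t : F) : F := t.

Lemma poly_line (F : fieldType) : polynomial_in (@line F) (fun t => t).
Proof. exact: poly_var tt. Qed.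

Lemma polynomial_in_line (F : fieldType) (h : F -> F) :
  polynomial_in (@line F) h -> exists p : {poly F}, forall t, p.[t] = h t.
Proof.
elim=> [a | t | h1 h2 _ [p1 p1P] _ [p2 p2P] | h1 h2 _ [p1 p1P] _ [p2 p2P]
       | h1 h2 eq_h _ [p pP]].
- by exists a%:P => c; rewrite hornerC.
- by exists 'X => c; rewrite hornerX.
- by exists (p1 + p2) => c; rewrite -p1P -p2P hornerD.
- by exists (p1 * p2) => c; rewrite -p1P -p2P hornerM.
- by exists p => c; rewrite pP eq_h.
Qed.

(** A nonzero polynomial has finitely many roots, so over an infinite field it
cannot vanish at every t != 0. *)
Lemma polynomial_in_line_continuous (F : numFieldType) (h : F -> F) :
  polynomial_in (@line F) h -> (forall t, t != 0 -> h t = 0) -> h 0 = 0.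
Proof.
move=> /polynomial_in_line [p pP] h0; rewrite -pP.
suff -> : p = 0 by rewrite horner0.
apply/eqP/contraT => p_neq0.
(* As many distinct nonzero roots as the size of p, one more than its degree. *)
pose s := [seq i.+1%:R : F | i <- iota 0 (size p)].
have := @max_poly_roots F p s p_neq0; rewrite size_map size_iota ltnn.
apply.
  by apply/allP=> _ /mapP [i _ ->]; rewrite /root pP h0 // pnatr_eq0.
by rewrite map_inj_uniq ?iota_uniq // => i j /eqP; rewrite eqr_nat => /eqP [].
Qed.

Definition degenerates (F : fieldType) (c d : structure F) : Prop :=
  forall p : {mpoly F[#|{: coord}|]},
    (forall b, orbit c b -> eval_at b p = 0) -> eval_at d p = 0.

(** The form in which degenerations are used: closed conditions are stated with
explicit polynomial functions instead of formal polynomials. *)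
Lemma degenerates_polynomial (F : fieldType) (c d : structure F) h :
  degenerates c d -> polynomial_in (@coordinate F) h ->
  (forall b, isomorphic c b -> h b = 0) -> h d = 0.
Proof.
move=> cd /polynomial_in_coordinates [p pP] h0; rewrite -pP; apply: cd => b.
by rewrite pP => /orbitP /h0.
Qed.

Lemma poly_mul_entry (F : fieldType) (x y : structure F -> 'cV[F]_3)
    (k : 'I_3) :
  (forall i, polynomial_in (@coordinate F) (fun c => x c i 0)) ->
  (forall j, polynomial_in (@coordinate F) (fun c => y c j 0)) ->
  polynomial_in (@coordinate F) (fun c => mul c (x c) (y c) k 0).
Proof.
move=> xP yP; pose term i j c := coordinate (i, j, k) c * x c i 0 * y c j 0.
apply: (@poly_ext _ _ _ _ (fun c => \sum_i \sum_j term i j c)).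
  by move=> c; rewrite mxE.
apply: poly_sum => i; apply: poly_sum => j.
by do 2!apply: poly_mul => //; exact: poly_var.
Qed.

(** The closure of an orbit is stable under the group: if p vanishes on the orbit
of b, so does its translate by g, whence p vanishes at g.c. *)
Lemma degenerates_trans (F : fieldType) (b c d : structure F) :
  degenerates b c -> degenerates c d -> degenerates b d.
Proof.
move=> bc cd p p0; apply: cd => _ [g g_unit ->].
apply: (degenerates_polynomial (h := fun a => eval_at (act g a) p) bc).
  apply: poly_eval_at => -[[i j] k].
  pose u l : 'cV[F]_3 := invmx g *m e l.+1.
  apply: (@poly_ext _ _ _ _ (fun a => \sum_l g k l * mul a (u i) (u j) l 0)).
    by move=> a; rewrite !ffunE /= [in RHS]mxE.
  apply: poly_sum => l; apply: poly_mul; first exact: poly_const.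
  by apply: poly_mul_entry => t; exact: poly_const.
move=> a ba; apply/p0/orbitP/(isomorphic_trans ba)/orbitP; by exists g.
Qed.

Lemma degenerates_curve (F : numFieldType) (c : structure F)
    (u : F -> structure F) :
  (forall t, polynomial_in (@line F) (fun s => u s t)) ->
  (forall t, t != 0 -> isomorphic c (u t)) -> degenerates c (u 0).
Proof.
move=> uP cu p p0.
apply: (@polynomial_in_line_continuous _ (fun t => eval_at (u t) p)).
  exact: poly_eval_at.
by move=> t t_neq0; apply/p0/orbitP/cu.
Qed.
(** * Invariants that survive degeneration *)

(** [invariant_closed] asks Q of the whole isomorphism class of c, as a polynomial
must vanish on the whole orbit before it is known to vanish on its closure. *)
Record closed_invariant (F : fieldType) (Q : structure F -> Prop) : Prop := {
  invariant_isomorphic : forall c d, isomorphic c d -> Q c -> Q d;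
  invariant_closed : forall c d, degenerates c d ->
    (forall b, isomorphic c b -> Q b) -> Q d }.

Lemma in_boundary_invariant (F : fieldType) (Q : structure F -> Prop)
    (a b : structure F) :
  closed_invariant Q -> in_boundary b a -> Q a -> Q b.
Proof.
move=> [Qiso Qclosed] [d d_iso_b [[_ a_to_d] _]] Qa.
by apply/(Qiso _ _ d_iso_b)/(Qclosed _ _ a_to_d) => c a_iso_c; apply: Qiso Qa.
Qed.

Lemma in_boundary_not_isomorphic (F : fieldType) (a b : structure F) :
  in_boundary b a -> ~ isomorphic b a.
Proof.
move=> [d d_iso_b [_ not_orbit]] b_iso_a; apply/not_orbit/orbitP.
exact/isomorphic_sym/(isomorphic_trans d_iso_b).
Qed.

(** The trace terms serve, with p = 1, q = 0 and r = -1/3, to subtract from the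
products of B1 and B2 the part x_1 y + y_1 x due to the unit: tr(L_x) is 3 x_1
there, whereas it vanishes on the nilpotent algebras. *)
Definition combined_product (F : fieldType) (p q r : F) (c : structure F)
    (x y : 'cV[F]_3) : 'cV[F]_3 :=
  p *: mul c x y + q *: mul c y x +
  r *: (\tr (left_mul c x) *: y + \tr (left_mul c y) *: x).

(** The map x |-> N(x, .) has rank at most one: all the 2 x 2 minors vanish.  They
are gathered in an identity of tensors u v^T, which a change of basis f turns
into f (u v^T) f^T. *)
Definition left_rank_le1 (F : fieldType) (p q r : F) (c : structure F) : Prop :=
  forall x x' y y',
    combined_product p q r c x y *m (combined_product p q r c x' y')^T =
    combined_product p q r c x' y *m (combined_product p q r c x y')^T.

Definition cube_zero (F : fieldType) (c : structure F) : Prop :=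
  forall x y z, mul c (mul c x y) z = 0 /\ mul c x (mul c y z) = 0.

Definition square_zero (F : fieldType) (c : structure F) : Prop :=
  forall x, mul c x x = 0.

(** An isomorphism f conjugates left multiplications: L_(f x) = f L_x f^-1. *)
Lemma trace_left_mul_isomorphic (F : fieldType) (c d : structure F)
    (f : 'M[F]_3) (x : 'cV[F]_3) :
  f \in unitmx -> (forall y z, f *m mul c y z = mul d (f *m y) (f *m z)) ->
  \tr (left_mul d (f *m x)) = \tr (left_mul c x).
Proof.
move=> f_unit fP.
have conj : f *m left_mul c x = left_mul d (f *m x) *m f.
  apply/row_matrixP=> i; apply/rowP=> j.
  by have /colP /(_ i) := fP x (delta_mx j 0);
    rewrite -!left_mulE !mulmxA -!colE !mxE.
by rewrite -[left_mul d _](mulmxK f_unit) -conj mxtrace_mulC mulKmx.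
Qed.

Lemma combined_product_isomorphic (F : fieldType) (p q r : F)
    (c d : structure F) (f : 'M[F]_3) (x y : 'cV[F]_3) :
  f \in unitmx -> (forall y z, f *m mul c y z = mul d (f *m y) (f *m z)) ->
  combined_product p q r d (f *m x) (f *m y) =
    f *m combined_product p q r c x y.
Proof.
move=> f_unit fP; rewrite /combined_product.
rewrite !(trace_left_mul_isomorphic _ f_unit fP) -!fP.
by rewrite !(mulmxDr, =^~ scalemxAr).
Qed.

Lemma left_rank_le1_invariant (F : fieldType) (p q r : F) :
  closed_invariant (left_rank_le1 p q r).
Proof.
split=> [c d [f f_unit fP] rank_c x x' y y' | c d cd rank_orbit x x' y y'].
  rewrite -[x](mulKVmx f_unit) -[x'](mulKVmx f_unit).
  rewrite -[y](mulKVmx f_unit) -[y'](mulKVmx f_unit).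
  rewrite !(combined_product_isomorphic _ _ _ _ _ f_unit fP) !trmx_mul.
  by rewrite !mulmxA -!(mulmxA f) rank_c.
pose N := combined_product p q r.
have NP z w k : polynomial_in (@coordinate F) (fun b => N b z w k 0).
  have mulP z' w' : polynomial_in (@coordinate F) (fun b => mul b z' w' k 0).
    by apply: poly_mul_entry => i; exact: poly_const.
  have trP z' :
      polynomial_in (@coordinate F) (fun b => \tr (left_mul b z')).
    pose term l i (b : structure F) := b (i, l, l) * z' i 0.
    apply: (@poly_ext _ _ _ _ (fun b => \sum_l \sum_i term l i b)).
      by move=> b; apply: eq_bigr => l _; rewrite mxE.
    apply: poly_sum => l; apply: poly_sum => i.
    by apply: poly_mul; [exact: poly_var | exact: poly_const].
  pose tr_part b := \tr (left_mul b z) * w k 0 + \tr (left_mul b w) * z k 0.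
  apply: (@poly_ext _ _ _ _ (fun b =>
      p * mul b z w k 0 + q * mul b w z k 0 + r * tr_part b)).
    by move=> b; rewrite /N /combined_product !mxE.
  by rewrite /tr_part; do !(apply: poly_add || apply: poly_mul => //);
    exact: poly_const.
apply/matrixP=> k l; rewrite !outer_prodE; apply/eqP; rewrite -subr_eq0.
apply/eqP; apply: (degenerates_polynomial (h := fun b =>
  N b x y k 0 * N b x' y' l 0 - N b x' y k 0 * N b x y' l 0) cd).
  by apply: poly_add; [|apply: poly_opp]; apply: poly_mul.
by move=> b cb; rewrite -!outer_prodE rank_orbit ?subrr.
Qed.

Lemma cube_zero_invariant (F : fieldType) : closed_invariant (@cube_zero F).
Proof.
split=> [c d [f f_unit fP] zero_c x y z | c d cd zero_orbit x y z].
  rewrite -[x](mulKVmx f_unit) -[y](mulKVmx f_unit) -[z](mulKVmx f_unit) -!fP.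
  have [-> ->] := zero_c (invmx f *m x) (invmx f *m y) (invmx f *m z).
  by rewrite mulmx0.
split; apply/colP=> k; rewrite [RHS]mxE.
  apply: (degenerates_polynomial (h := fun b => mul b (mul b x y) z k 0) cd).
    apply: poly_mul_entry => i; last exact: poly_const.
    by apply: poly_mul_entry => j; exact: poly_const.
  by move=> b cb; have [-> _] := zero_orbit b cb x y z; rewrite mxE.
apply: (degenerates_polynomial (h := fun b => mul b x (mul b y z) k 0) cd).
  apply: poly_mul_entry => i; first exact: poly_const.
  by apply: poly_mul_entry => j; exact: poly_const.
by move=> b cb; have [_ ->] := zero_orbit b cb x y z; rewrite mxE.
Qed.

Lemma square_zero_invariant (F : fieldType) : closed_invariant (@square_zero F).
Proof.
split=> [c d [f f_unit fP] zero_c x | c d cd zero_orbit x].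
  by rewrite -[x](mulKVmx f_unit) -fP zero_c mulmx0.
apply/colP=> k; rewrite [RHS]mxE.
apply: (degenerates_polynomial (h := fun b => mul b x x k 0) cd).
  by apply: poly_mul_entry => i; exact: poly_const.
by move=> b cb; rewrite zero_orbit // mxE.
Qed.

(** * The two families containing the five algebras *)

Definition unital_product (F : fieldType) (u : F) (i j : nat) : 'cV[F]_3 :=
  match i, j with
  | 1%N, 1%N => e 1
  | 1%N, 2%N => e 2 + e 3
  | 1%N, 3%N => e 3
  | 2%N, 1%N => e 2
  | 2%N, 2%N => u *: e 3
  | 3%N, 1%N => e 3
  | _, _ => 0
  end.

Definition unital (F : fieldType) (u : F) : structure F :=
  structure_of_basis_products (fun i j : 'I_3 => unital_product u i.+1 j.+1).

Definition nil_product (F : fieldType) (a u v : F) (i j : nat) : 'cV[F]_3 :=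
  match i, j with
  | 1%N, 2%N => a *: e 3
  | 2%N, 1%N => (a - 1) *: e 3
  | 2%N, 2%N => u *: e 1 + v *: e 3
  | _, _ => 0
  end.

Definition nil_alg (F : fieldType) (a u v : F) : structure F :=
  structure_of_basis_products (fun i j : 'I_3 => nil_product a u v i.+1 j.+1).

(** The algebra [unital 1] (for a != 0) or [unital 0] (for a = 0), in a basis that
degenerates as t tends to 0.  Write xy = x_1 y + y_1 x + N(x, y) in a unital
algebra and take E_2 with first coordinate t.  Setting E_1 = N(E_2, E_2) gives
E_2 E_2 = E_1 + 2 t E_2, which tends to E_1, and up to terms tending to 0 both
E_1 E_2 and E_2 E_1 are multiples of e_3.  In [unital 1], the second coordinate
-a t of E_2 makes these multiples have ratio a : a - 1. *)
Definition collapsing_product (F : fieldType) (a t : F) (i j : nat) :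
    'cV[F]_3 :=
  match i, j with
  | 1%N, 1%N => (- t ^+ 2) *: e 1 + (- t * (a - 1)) *: e 3
  | 1%N, 2%N => (- t ^+ 2) *: e 2 + a *: e 3
  | 1%N, 3%N => (- t ^+ 2) *: e 3
  | 2%N, 1%N => (- t ^+ 2) *: e 2 + (a - 1) *: e 3
  | 2%N, 2%N => e 1 + (2 * t) *: e 2
  | 2%N, 3%N => t *: e 3
  | 3%N, 1%N => (- t ^+ 2) *: e 3
  | 3%N, 2%N => t *: e 3
  | _, _ => 0
  end.

Definition collapsing (F : fieldType) (a t : F) : structure F :=
  structure_of_basis_products
    (fun i j : 'I_3 => collapsing_product a t i.+1 j.+1).

Lemma mul_unital (F : fieldType) (u a b c a' b' c' : F) :
  mul (unital u) (vec a b c) (vec a' b' c') =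
    vec (a * a') (a * b' + b * a') (a * b' + a * c' + c * a' + u * b * b').
Proof.
rewrite mul_structure_of_basis_products !sum_ord3 /= !e_vec !mxE /=.
rewrite vec0 !(vecZ, vecD); congr vec; ring.
Qed.

Lemma mul_nil (F : fieldType) (a u v x y z x' y' z' : F) :
  mul (nil_alg a u v) (vec x y z) (vec x' y' z') =
    vec (u * y * y') 0 (a * x * y' + (a - 1) * y * x' + v * y * y').
Proof.
rewrite mul_structure_of_basis_products !sum_ord3 /= !e_vec !mxE /=.
rewrite vec0 !(vecZ, vecD); congr vec; ring.
Qed.

Lemma mul_collapsing (F : fieldType) (a t x y z x' y' z' : F) :
  mul (collapsing a t) (vec x y z) (vec x' y' z') =
    vec (- t ^+ 2 * x * x' + y * y')
      (- t ^+ 2 * (x * y' + y * x') + 2 * t * y * y')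
      (- t * (a - 1) * x * x' + a * x * y' + (a - 1) * y * x'
       - t ^+ 2 * (x * z' + z * x') + t * (y * z' + z * y')).
Proof.
rewrite mul_structure_of_basis_products !sum_ord3 /= !e_vec !mxE /=.
rewrite vec0 !(vecZ, vecD); congr vec; ring.
Qed.


Lemma structure_of_B1 (F : fieldType) : @B1 F = unital 0 :> structure F.
Proof.
apply: mul_inj; elim/vec_ind=> a b c; elim/vec_ind=> a' b' c'.
rewrite mul_unital mul_structure_of_basis_products !sum_ord3 /= !e_vec !mxE /=.
rewrite vec0 !(vecZ, vecD); congr vec; ring.
Qed.

Lemma structure_of_B2 (F : fieldType) : @B2 F = unital 1 :> structure F.
Proof.
apply: mul_inj; elim/vec_ind=> a b c; elim/vec_ind=> a' b' c'.
rewrite mul_unital mul_structure_of_basis_products !sum_ord3 /= !e_vec !mxE /=.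
rewrite vec0 !(vecZ, vecD); congr vec; ring.
Qed.

Lemma structure_of_B3 (F : numFieldType) :
  @B3 F = nil_alg (1 / 2) 0 1 :> structure F.
Proof.
apply: mul_inj; elim/vec_ind=> a b c; elim/vec_ind=> a' b' c'.
rewrite mul_nil mul_structure_of_basis_products !sum_ord3 /= !e_vec !mxE /=.
rewrite vec0 !(vecZ, vecD); congr vec; by field.
Qed.

Lemma structure_of_B4 (F : fieldType) (a : F) :
  B4 a = nil_alg a 1 0 :> structure F.
Proof.
apply: mul_inj; elim/vec_ind=> x y z; elim/vec_ind=> x' y' z'.
rewrite mul_nil mul_structure_of_basis_products !sum_ord3 /= !e_vec !mxE /=.
rewrite vec0 !(vecZ, vecD); congr vec; ring.
Qed.

Lemma structure_of_B5 (F : fieldType) (b : F) :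
  B5 b = nil_alg b 0 0 :> structure F.
Proof.
apply: mul_inj; elim/vec_ind=> x y z; elim/vec_ind=> x' y' z'.
rewrite mul_nil mul_structure_of_basis_products !sum_ord3 /= !e_vec !mxE /=.
rewrite vec0 !(vecZ, vecD); congr vec; ring.
Qed.

(** * Values of the invariants on the two families *)

Lemma combined_product_unital (F : fieldType) (p q r u a b c a' b' c' : F) :
  combined_product p q r (unital u) (vec a b c) (vec a' b' c') =
    vec ((p + q + 6 * r) * a * a')
      ((p + q + 3 * r) * (a * b' + b * a'))
      (p * a * b' + q * a' * b + (p + q + 3 * r) * (a * c' + c * a')
       + (p + q) * u * b * b').
Proof.
have tr x y z : \tr (left_mul (unital u) (vec x y z)) = 3 * x.
  rewrite /mxtrace sum_ord3 !mxE !sum_ord3 /unital !ffunE /=.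
  by rewrite !e_vec !mxE /=; ring.
rewrite /combined_product !tr !mul_unital !(vecZ, vecD); congr vec; ring.
Qed.

Lemma combined_product_nil (F : fieldType) (p q r a u v x y z x' y' z' : F) :
  combined_product p q r (nil_alg a u v) (vec x y z) (vec x' y' z') =
    vec ((p + q) * u * y * y') 0
      ((p * a + q * (a - 1)) * x * y' + (p * (a - 1) + q * a) * y * x'
       + (p + q) * v * y * y').
Proof.
have tr x1 y1 z1 : \tr (left_mul (nil_alg a u v) (vec x1 y1 z1)) = 0.
  rewrite /mxtrace sum_ord3 !mxE !sum_ord3 /nil_alg !ffunE /=.
  by rewrite !e_vec !mxE /=; ring.
rewrite /combined_product !tr !mul_nil !(vecZ, vecD); congr vec; ring.
Qed.

(** Here p + q + 3 r = 0 removes the unit, leaving x_1 (y_2 e_3 - y_1 e_1). *)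
Lemma unital_left_rank_le1 (F : numFieldType) :
  left_rank_le1 1 0 (- 3^-1) (unital (0 : F)).
Proof.
do 4!elim/vec_ind=> ? ? ?; apply/matrixP=> k l.
rewrite !outer_prodE !combined_product_unital !mxE.
by elim/ord3_ind: k; elim/ord3_ind: l; rewrite /=; field.
Qed.

Lemma unital_left_rank_le1_inv (F : fieldType) (p q r u : F) :
  left_rank_le1 p q r (unital u) ->
  p + q + 3 * r = 0 /\ (p + q + 6 * r) * (p + q) * u = 0.
Proof.
move=> rank; split.
  (* On the second coordinate the minor is minus the square of p + q + 3 r. *)
  have := rank (e 1) (e 2) (e 1) (e 2); rewrite !e_vec => /matrixP /(_ i1 i1).
  rewrite !outer_prodE !combined_product_unital !mxE /= => /esym/eqP.
  rewrite -subr_eq0 => /eqP eq0; apply/eqP; rewrite -sqrf_eq0 expr2.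
  by apply/eqP/(etrans _ eq0); ring.
have := rank (e 1) (e 2) (e 1) (e 2); rewrite !e_vec => /matrixP /(_ i0 i2).
rewrite !outer_prodE !combined_product_unital !mxE /= => /eqP.
rewrite -subr_eq0 => /eqP eq0; apply: etrans eq0; ring.
Qed.

(** The coefficient p a + q (a - 1) of x_1 y_2 cancels, so that only terms
divisible by x_2 remain. *)
Lemma nil_left_rank_le1 (F : fieldType) (a u v : F) :
  left_rank_le1 (a - 1) (- a) 0 (nil_alg a u v).
Proof.
do 4!elim/vec_ind=> ? ? ?; apply/matrixP=> k l.
rewrite !outer_prodE !combined_product_nil !mxE.
by elim/ord3_ind: k; elim/ord3_ind: l; rewrite /=; ring.
Qed.

Lemma nil_left_rank_le1_inv (F : fieldType) (p q r a u v : F) :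
  left_rank_le1 p q r (nil_alg a u v) ->
  (p + q) * u * (p * a + q * (a - 1)) = 0 /\
  (p * a + q * (a - 1)) * (p * (a - 1) + q * a) = 0.
Proof.
move=> rank; split.
  have := rank (e 2) (e 1) (e 2) (e 2); rewrite !e_vec => /matrixP /(_ i0 i2).
  rewrite !outer_prodE !combined_product_nil !mxE /= => /eqP.
  rewrite -subr_eq0 => /eqP eq0; apply: etrans eq0; ring.
have := rank (e 1) (e 2) (e 2) (e 1); rewrite !e_vec => /matrixP /(_ i2 i2).
rewrite !outer_prodE !combined_product_nil !mxE /= => /eqP.
rewrite -subr_eq0 => /eqP eq0; apply: etrans eq0; ring.
Qed.

Lemma nil_cube_zero (F : fieldType) (a v : F) : cube_zero (nil_alg a 0 v).
Proof.
do 3!elim/vec_ind=> ? ? ?; rewrite !mul_nil vec0.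
by split; congr vec; ring.
Qed.

Lemma nil_cube_zero_inv (F : fieldType) (a u v : F) :
  cube_zero (nil_alg a u v) -> u = 0.
Proof.
move=> /(_ (e 2) (e 2) (e 2)); rewrite !e_vec !mul_nil vec0.
(* (e2 e2) e2 = u a e3 and e2 (e2 e2) = u (a - 1) e3 differ by u e3. *)
move=> [/vec_inj [_ _ left0] /vec_inj [_ _ right0]].
apply: etrans (etrans (congr2 (fun s t => s - t) left0 right0) (subrr 0)); ring.
Qed.

Lemma nil_square_zero (F : numFieldType) :
  square_zero (nil_alg (1 / 2 : F) 0 0).
Proof. by elim/vec_ind=> x y z; rewrite mul_nil vec0; congr vec; field. Qed.

Lemma nil_square_zero_inv (F : fieldType) (a u v : F) :
  square_zero (nil_alg a u v) -> v = 0.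
Proof.
move=> /(_ (e 2)); rewrite !e_vec mul_nil vec0 => /vec_inj [_ _ eq0].
apply: etrans eq0; ring.
Qed.

(** * Isomorphisms and degenerations between the families *)

Lemma unital_scaling (F : fieldType) (t : F) :
  t != 0 -> isomorphic (unital t) (unital 1).
Proof.
move=> t0.
apply: (isomorphic_from_columns (u := vec 1 0 0) (v := vec 0 t 0)
  (w := vec 0 0 t)).
  by rewrite det_from_columns !(mul0r, mulr0, subr0, addr0, mul1r) mulf_neq0.
do 2!elim/vec_ind=> ? ? ?.
by rewrite !(mul_unital, from_columns_mul, vecZ, vecD); congr vec; ring.
Qed.

Lemma nil_scaling (F : fieldType) (a u v t : F) :
  t != 0 -> isomorphic (nil_alg a (t ^+ 2 * u) (t * v)) (nil_alg a u v).
Proof.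
move=> t0.
apply: (isomorphic_from_columns (u := vec 1 0 0) (v := vec 0 t 0)
  (w := vec 0 0 t)).
  by rewrite det_from_columns !(mul0r, mulr0, subr0, addr0, mul1r) mulf_neq0.
do 2!elim/vec_ind=> ? ? ?.
by rewrite !(mul_nil, from_columns_mul, vecZ, vecD); congr vec; ring.
Qed.

(** The term x_2 y_2 of the product has value u e_1 + v e_3.  Tilting e_1 towards
e_3 moves this value from e_1 to t e_1 + e_3, which is e_3 at t = 0, and leaves
the products with e_1 unchanged. *)
Lemma nil_shear (F : fieldType) (a t : F) :
  t != 0 -> isomorphic (nil_alg a 1 0) (nil_alg a t 1).
Proof.
move=> t0.
apply: (isomorphic_from_columns (u := vec t 0 1) (v := vec 0 1 0)
  (w := vec 0 0 t)).
  by rewrite det_from_columns !(mul0r, mulr0, subr0, addr0, mul1r) mulf_neq0.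
do 2!elim/vec_ind=> ? ? ?.
by rewrite !(mul_nil, from_columns_mul, vecZ, vecD); congr vec; ring.
Qed.

Lemma nil_swap (F : fieldType) (a : F) :
  isomorphic (nil_alg a 0 0) (nil_alg (1 - a) 0 0).
Proof.
apply: (isomorphic_from_columns (u := vec 0 1 0) (v := vec 1 0 0)
  (w := vec 0 0 (- 1))).
  rewrite det_from_columns !(mul0r, mulr0, subr0, addr0, mul1r, sub0r, mulr1).
  by rewrite opprK oner_eq0.
do 2!elim/vec_ind=> ? ? ?.
by rewrite !(mul_nil, from_columns_mul, vecZ, vecD); congr vec; ring.
Qed.

Lemma collapsing_unital0 (F : fieldType) (t : F) :
  t != 0 -> isomorphic (collapsing 0 t) (unital 0).
Proof.
move=> t0.
apply: (isomorphic_from_columns (u := vec (- t ^+ 2) 0 t) (v := vec t 1 0)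
  (w := vec 0 0 (- t ^+ 2))).
  rewrite det_from_columns (_ : _ + _ = t ^+ 4) ?expf_neq0 //; ring.
do 2!elim/vec_ind=> ? ? ?.
rewrite !(mul_collapsing, mul_unital, from_columns_mul, vecZ, vecD).
by congr vec; ring.
Qed.

Lemma collapsing_unital1 (F : fieldType) (a t : F) :
  a != 0 -> t != 0 -> isomorphic (collapsing a t) (unital 1).
Proof.
move=> a0 t0.
apply: (isomorphic_from_columns (u := vec (- t ^+ 2) 0 (a * (a - 1) * t ^+ 2))
  (v := vec t (- (a * t)) 0) (w := vec 0 0 (a * t ^+ 3))).
  rewrite det_from_columns (_ : _ + _ = a ^+ 2 * t ^+ 6).
    by rewrite mulf_neq0 ?expf_neq0.
  ring.
do 2!elim/vec_ind=> ? ? ?.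
rewrite !(mul_collapsing, mul_unital, from_columns_mul, vecZ, vecD).
by congr vec; ring.
Qed.

Lemma collapsing0 (F : fieldType) (a : F) : collapsing a 0 = nil_alg a 1 0.
Proof.
apply: mul_inj; do 2!elim/vec_ind=> ? ? ?.
rewrite mul_collapsing mul_nil; congr vec; ring.
Qed.

Lemma collapsing_polynomial (F : fieldType) (a : F) t :
  polynomial_in (@line F) (fun s => collapsing a s t).
Proof.
apply: poly_structure t => i j k; have tP := @poly_line F.
have sqP : polynomial_in (@line F) (fun s => - s ^+ 2).
  exact/poly_opp/poly_exp.
have dblP : polynomial_in (@line F) (fun s => 2 * s).
  by apply: poly_mul => //; exact: poly_const.
have mulP : polynomial_in (@line F) (fun s => - s * (a - 1)).
  by apply: poly_mul; [exact: poly_opp | exact: poly_const].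
by elim/ord3_ind: i; elim/ord3_ind: j => /=;
   do ?[exact: poly_const | exact: poly_col_scale | apply: poly_col_add].
Qed.

Lemma unital_polynomial (F : fieldType) t :
  polynomial_in (@line F) (fun s => unital s t).
Proof.
apply: poly_structure t => i j k; have tP := @poly_line F.
by elim/ord3_ind: i; elim/ord3_ind: j => /=;
   do ?[exact: poly_const | exact: poly_col_scale].
Qed.

Lemma nil_polynomial (F : fieldType) (a : F) (u v : F -> F) t :
  polynomial_in (@line F) u -> polynomial_in (@line F) v ->
  polynomial_in (@line F) (fun s => nil_alg a (u s) (v s) t).
Proof.
move=> uP vP; apply: poly_structure t => i j k.
by elim/ord3_ind: i; elim/ord3_ind: j => /=;
   do ?[exact: poly_const | exact: poly_col_scale | apply: poly_col_add].
Qed.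

Lemma unital1_degenerates_unital0 (F : numFieldType) :
  degenerates (unital (1 : F)) (unital 0).
Proof.
apply: (degenerates_curve (u := @unital F)); first exact: unital_polynomial.
by move=> t t0; apply/isomorphic_sym/unital_scaling.
Qed.

Lemma unital0_degenerates_nil (F : numFieldType) :
  degenerates (unital (0 : F)) (nil_alg 0 1 0).
Proof.
rewrite -collapsing0; apply: degenerates_curve.
  exact: collapsing_polynomial.
by move=> t t0; apply/isomorphic_sym/collapsing_unital0.
Qed.

(** The curve [collapsing a] stays in the orbit of [unital 1] only for a != 0; the
missing case passes through [unital 0]. *)
Lemma unital1_degenerates_nil (F : numFieldType) (a : F) :
  degenerates (unital 1) (nil_alg a 1 0).
Proof.
have [->|a0] := eqVneq a 0.
  exact: degenerates_trans (@unital1_degenerates_unital0 F)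
    (@unital0_degenerates_nil F).
rewrite -collapsing0; apply: degenerates_curve.
  exact: collapsing_polynomial.
by move=> t t0; apply/isomorphic_sym/collapsing_unital1.
Qed.

Lemma nil_degenerates_nil00 (F : numFieldType) (a u v : F) :
  degenerates (nil_alg a u v) (nil_alg a 0 0).
Proof.
pose c (t : F) := nil_alg a (t ^+ 2 * u) (t * v).
have -> : nil_alg a 0 0 = c 0 by rewrite /c expr2 !mul0r.
apply: degenerates_curve => [t | t t0]; last exact/isomorphic_sym/nil_scaling.
apply: nil_polynomial; apply: poly_mul; try exact: poly_const.
  exact/poly_exp/poly_line.
exact: poly_line.
Qed.

Lemma nil_degenerates_nil01 (F : numFieldType) (a : F) :
  degenerates (nil_alg a 1 0) (nil_alg a 0 1).
Proof.
apply: (degenerates_curve (u := fun t => nil_alg a t 1)) => [t | t t0].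
  by apply: nil_polynomial; [exact: poly_line | exact: poly_const].
exact: nil_shear.
Qed.

(** * The boundaries *)

(** A degeneration to C lands in the boundary as soon as an invariant separates C
from A; unlike an obstruction, Q holds on the target and fails on the source. *)
Lemma degeneration_in_boundary (F : fieldType) (A B C : algebra F)
    (Q : structure F -> Prop) :
  closed_invariant Q -> degenerates A C -> Q C -> ~ Q A -> isomorphic B C ->
  in_boundary B A.
Proof.
move=> [Qiso _] AC QC notQA BC; exists C; first exact: isomorphic_sym.
split=> [|/orbitP CA]; first by split=> //; exact: structure_of_novikov.
by apply/notQA/(Qiso C)=> //; exact: isomorphic_sym.
Qed.

Lemma isomorphic_B5 (F : fieldType) (a b : F) :
  (b - a) * (b - (1 - a)) = 0 -> isomorphic (B5 b) (B5 a).
Proof.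
rewrite !structure_of_B5 => /eqP; rewrite mulf_eq0 !subr_eq0.
move=> /orP [] /eqP ->; first exact: isomorphic_refl.
by have := nil_swap (1 - a); rewrite subKr.
Qed.

Lemma left_rank_le1_B5 (F : fieldType) (a b : F) :
  left_rank_le1 (a - 1) (- a) 0 (B5 b) -> isomorphic (B5 b) (B5 a).
Proof.
rewrite {1}structure_of_B5 => /nil_left_rank_le1_inv [_ eq0].
by apply: isomorphic_B5; apply: etrans eq0; ring.
Qed.

Lemma left_rank_le1_B4 (F : fieldType) (a b : F) :
  left_rank_le1 (a - 1) (- a) 0 (B4 b) -> b = a.
Proof.
rewrite structure_of_B4 => /nil_left_rank_le1_inv [eq0 _].
by apply: subr0_eq; apply: etrans eq0; ring.
Qed.

Lemma left_rank_le1_B3 (F : numFieldType) (a : F) :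
  left_rank_le1 (a - 1) (- a) 0 B3 -> a = 1 / 2.
Proof.
rewrite structure_of_B3 => /nil_left_rank_le1_inv [_ eq0].
apply/eqP; rewrite -subr_eq0 -sqrf_eq0; apply/eqP.
by rewrite -oppr0 -eq0; field.
Qed.

Lemma not_left_rank_le1_unital (F : fieldType) (a u : F) :
  ~ left_rank_le1 (a - 1) (- a) 0 (unital u).
Proof.
move=> /unital_left_rank_le1_inv [eq0 _].
have /eqP : -1 = 0 :> F by apply: etrans eq0; ring.
by rewrite oppr_eq0 oner_eq0.
Qed.

Lemma in_boundary_B1 (F : numFieldType) (B : algebra F) :
  in_boundary B B1 <-> isomorphic B (B4 0) \/ isomorphic B (B5 0).
Proof.
split=> [B_B1 | ].
  have := in_boundary_invariant (left_rank_le1_invariant _ _ _) B_B1.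
  rewrite structure_of_B1 => /(_ _ _ _ (@unital_left_rank_le1 F)).
  have := in_boundary_not_isomorphic B_B1.
  case: B {B_B1} => [||| a | b].
  - by case; exact: isomorphic_refl.
  - rewrite structure_of_B2 => _ /unital_left_rank_le1_inv [_ eq0].
    have /eqP : -1 = 0 :> F by apply: etrans eq0; field.
    by rewrite oppr_eq0 oner_eq0.
  - rewrite structure_of_B3 => _ /nil_left_rank_le1_inv [_ eq0].
    have /eqP : - 4^-1 = 0 :> F by apply: etrans eq0; field.
    by rewrite oppr_eq0 invr_eq0 pnatr_eq0.
  - rewrite structure_of_B4 => _ /nil_left_rank_le1_inv [eq0 _]; left.
    rewrite (_ : a = 0) -?structure_of_B4; first exact: isomorphic_refl.
    by apply: etrans eq0; ring.
  - rewrite structure_of_B5 => _ /nil_left_rank_le1_inv [_ eq0]; right.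
    by rewrite -structure_of_B5; apply: isomorphic_B5; apply: etrans eq0; ring.
have B1_B4 : degenerates (@B1 F) (B4 0).
  by rewrite structure_of_B1 structure_of_B4; exact: unital0_degenerates_nil.
have nB1 : ~ left_rank_le1 (0 - 1) (- 0) 0 (@B1 F).
  by rewrite structure_of_B1; exact: not_left_rank_le1_unital.
have inv := left_rank_le1_invariant (0 - 1) (- 0) (0 : F).
case; apply: (degeneration_in_boundary inv) => //.
- by rewrite structure_of_B4; exact: nil_left_rank_le1.
- apply: degenerates_trans B1_B4 _; rewrite structure_of_B4 structure_of_B5.
  exact: nil_degenerates_nil00.
- by rewrite structure_of_B5; exact: nil_left_rank_le1.
Qed.

Lemma in_boundary_B2 (F : numFieldType) (B : algebra F) :
  in_boundary B B2 <->
    isomorphic B B1 \/ isomorphic B B3 \/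
    (exists alpha, isomorphic B (B4 alpha)) \/
    (exists beta, isomorphic B (B5 beta)).
Proof.
split=> [/in_boundary_not_isomorphic | ].
  case: B => [||| a | b] not_B2.
  - by left; exact: isomorphic_refl.
  - by case: not_B2; exact: isomorphic_refl.
  - by right; left; exact: isomorphic_refl.
  - by right; right; left; exists a; exact: isomorphic_refl.
  - by right; right; right; exists b; exact: isomorphic_refl.
have B2_B4 a : degenerates (@B2 F) (B4 a).
  by rewrite structure_of_B2 structure_of_B4; exact: unital1_degenerates_nil.
have nB2 a : ~ left_rank_le1 (a - 1) (- a) 0 (@B2 F).
  by rewrite structure_of_B2; exact: not_left_rank_le1_unital.
have inv a := left_rank_le1_invariant (a - 1) (- a) (0 : F).
move=> [|[|[] [a]]].
- apply: (degeneration_in_boundary (left_rank_le1_invariant 1 0 (- 3^-1))).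
  + rewrite structure_of_B1 structure_of_B2.
    exact: unital1_degenerates_unital0.
  + by rewrite structure_of_B1; exact: unital_left_rank_le1.
  + rewrite structure_of_B2 => /unital_left_rank_le1_inv [_ eq0].
    have /eqP : -1 = 0 :> F by apply: etrans eq0; field.
    by rewrite oppr_eq0 oner_eq0.
- apply: (degeneration_in_boundary (inv (1 / 2))) => //.
  + apply: degenerates_trans (B2_B4 (1 / 2)) _.
    by rewrite structure_of_B3 structure_of_B4; exact: nil_degenerates_nil01.
  + by rewrite structure_of_B3; exact: nil_left_rank_le1.
- apply: (degeneration_in_boundary (inv a)) => //.
  by rewrite structure_of_B4; exact: nil_left_rank_le1.
- apply: (degeneration_in_boundary (inv a)) => //.
  + apply: degenerates_trans (B2_B4 a) _; rewrite structure_of_B4 structure_of_B5.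
    exact: nil_degenerates_nil00.
  + by rewrite structure_of_B5; exact: nil_left_rank_le1.
Qed.

Lemma in_boundary_B3 (F : numFieldType) (B : algebra F) :
  in_boundary B B3 <-> isomorphic B (B5 (1 / 2)).
Proof.
split=> [B_B3 | ].
  have := in_boundary_invariant (left_rank_le1_invariant _ _ _) B_B3.
  have := in_boundary_invariant (@cube_zero_invariant F) B_B3.
  have := in_boundary_not_isomorphic B_B3.
  rewrite structure_of_B3 => not_B3 /(_ (@nil_cube_zero _ _ _)) cube.
  move=> /(_ _ _ _ (@nil_left_rank_le1 _ _ _ _)) rank.
  case: B {B_B3} not_B3 cube rank => [||| a | b] not_B3 cube rank.
  - by case: (@not_left_rank_le1_unital F (1 / 2) 0); rewrite -structure_of_B1.
  - by case: (@not_left_rank_le1_unital F (1 / 2) 1); rewrite -structure_of_B2.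
  - by case: not_B3; rewrite structure_of_B3; exact: isomorphic_refl.
  - move: cube; rewrite structure_of_B4 => /nil_cube_zero_inv /eqP.
    by rewrite oner_eq0.
  - exact: left_rank_le1_B5.
apply: (degeneration_in_boundary (@square_zero_invariant F)).
- by rewrite structure_of_B3 structure_of_B5; exact: nil_degenerates_nil00.
- by rewrite structure_of_B5; exact: nil_square_zero.
- by rewrite structure_of_B3 => /nil_square_zero_inv /eqP; rewrite oner_eq0.
Qed.

Lemma in_boundary_B4_cases (F : numFieldType) (a : F) (B : algebra F) :
  in_boundary B (B4 a) ->
  a = 1 / 2 /\ isomorphic B B3 \/ isomorphic B (B5 a).
Proof.
move=> B_B4; have := in_boundary_not_isomorphic B_B4.
have := in_boundary_invariant (left_rank_le1_invariant (a - 1) (- a) 0) B_B4.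
rewrite structure_of_B4 => /(_ (@nil_left_rank_le1 _ _ _ _)).
case: B {B_B4} => [||| b | b] rank not_B4.
- by case: (@not_left_rank_le1_unital F a 0); rewrite -structure_of_B1.
- by case: (@not_left_rank_le1_unital F a 1); rewrite -structure_of_B2.
- by left; split; [exact: left_rank_le1_B3 | exact: isomorphic_refl].
- case: not_B4; rewrite (left_rank_le1_B4 rank) structure_of_B4.
  exact: isomorphic_refl.
- by right; exact: left_rank_le1_B5.
Qed.

Lemma B5_in_boundary_B4 (F : numFieldType) (a : F) (B : algebra F) :
  isomorphic B (B5 a) -> in_boundary B (B4 a).
Proof.
apply: (degeneration_in_boundary (@cube_zero_invariant F)).
- by rewrite structure_of_B4 structure_of_B5; exact: nil_degenerates_nil00.
- by rewrite structure_of_B5; exact: nil_cube_zero.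
- by rewrite structure_of_B4 => /nil_cube_zero_inv /eqP; rewrite oner_eq0.
Qed.

Lemma B3_in_boundary_B4 (F : numFieldType) (B : algebra F) :
  isomorphic B B3 -> in_boundary B (B4 (1 / 2)).
Proof.
apply: (degeneration_in_boundary (@cube_zero_invariant F)).
- by rewrite structure_of_B4 structure_of_B3; exact: nil_degenerates_nil01.
- by rewrite structure_of_B3; exact: nil_cube_zero.
- by rewrite structure_of_B4 => /nil_cube_zero_inv /eqP; rewrite oner_eq0.
Qed.

Lemma boundary_B5_empty (F : numFieldType) (b : F) (B : algebra F) :
  ~ in_boundary B (B5 b).
Proof.
move=> B_B5; apply: (in_boundary_not_isomorphic B_B5).
have := in_boundary_invariant (left_rank_le1_invariant (b - 1) (- b) 0) B_B5.
have := in_boundary_invariant (@cube_zero_invariant F) B_B5.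
have := in_boundary_invariant (@square_zero_invariant F) B_B5.
rewrite structure_of_B5 => square /(_ (@nil_cube_zero _ _ _)) cube.
move=> /(_ (@nil_left_rank_le1 _ _ _ _)) rank.
case: B {B_B5} square cube rank => [||| a | a] square cube rank.
- by case: (@not_left_rank_le1_unital F b 0); rewrite -structure_of_B1.
- by case: (@not_left_rank_le1_unital F b 1); rewrite -structure_of_B2.
- move: square; rewrite (left_rank_le1_B3 rank) structure_of_B3.
  move=> /(_ (@nil_square_zero F)) /nil_square_zero_inv /eqP.
  by rewrite oner_eq0.
- move: cube; rewrite structure_of_B4 => /nil_cube_zero_inv /eqP.
  by rewrite oner_eq0.
- by rewrite -structure_of_B5; exact: left_rank_le1_B5.
Qed.

Theorem proposition4p2 (R : realType) :
  (forall B : algebra R[i],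
     in_boundary B B1 <-> isomorphic B (B4 0) \/ isomorphic B (B5 0)) /\
  (forall B : algebra R[i],
     in_boundary B B2 <->
       isomorphic B B1 \/ isomorphic B B3 \/
       (exists alpha : R[i], isomorphic B (B4 alpha)) \/
       (exists beta : R[i], isomorphic B (B5 beta))) /\
  (forall B : algebra R[i],
     in_boundary B B3 <-> isomorphic B (B5 (1 / 2))) /\
  (forall (alpha : R[i]) (B : algebra R[i]), alpha <> 1 / 2 ->
     (in_boundary B (B4 alpha) <-> isomorphic B (B5 alpha))) /\
  (forall B : algebra R[i],
     in_boundary B (B4 (1 / 2)) <->
       isomorphic B B3 \/ isomorphic B (B5 (1 / 2))) /\
  (forall (beta : R[i]) (B : algebra R[i]), ~ in_boundary B (B5 beta)).
Proof.
split; first exact: in_boundary_B1.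
split; first exact: in_boundary_B2.
split; first exact: in_boundary_B3.
split.
  move=> alpha B alpha_neq; split; last exact: B5_in_boundary_B4.
  by case/in_boundary_B4_cases => // -[].
split; last exact: boundary_B5_empty.
move=> B; split=> [/in_boundary_B4_cases [[_]|] | []]; [by left | by right | |].
  exact: B3_in_boundary_B4.
exact: B5_in_boundary_B4.
Qed.
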